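(* Let $D>0$, let $(\mathcal X,\|\cdot\|)$ be a $(2,D)$-smooth separable Banach space, and let $f\in\mathcal M(\mathcal X)$ be such that $\|d^*\|_\infty\le a$ and $\|s_2\|_\infty\le b/D$ for some $a>0$, $b>0$. Then for all $r\ge0$, $$\mathbf{Pr}(f^*\ge r)\le 2\exp\left[\frac ra-\left(\frac ra+\frac{b^2}{a^2}\right)\ln\left(1+\frac{ra}{b^2}\right)\right]\le 2\left(\frac{e b^2}{ra}\right)^{r/a},$$ where for $r=0$ the last expression is read as $2$.
   Context: A real Banach space $(\mathcal X,\|\cdot\|)$ is called $(2,D)$-smooth if $\|x+y\|^2+\|x-y\|^2\le 2\|x\|^2+2D^2\|y\|^2$ for all $x,y\in\mathcal X$. For a separable Banach space $\mathcal X$, $\mathcal M(\mathcal X)$ is the class of all martingales $f=(f_0,f_1,\ldots)$ of Bochner-integrable random vectors in $\mathcal X$ with $f_0\equiv 0$, defined on some probability space with respect to some filtration $(F_0,F_1,\ldots)$ (both may depend on $f$). Put $d_0=0$, $d_j=f_j-f_{j-1}$ for $j\ge1$, $f^*=\sup_{j\ge0}\|f_j\|$, $d^*=\sup_{j\ge0}\|d_j\|$, $s_2=\left(\sum_{j=1}^\infty\mathbf E_{j-1}\|d_j\|^2\right)^{1/2}$, where $\mathbf E_{j-1}$ is the conditional expectation given $F_{j-1}$; $\|\cdot\|_\infty$ of a real random variable is its essential supremum norm. *)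

(* Defs.v *)
From HB Require Import structures.
From mathcomp Require Export all_boot all_order all_algebra.
From mathcomp Require Export all_classical all_reals all_analysis measurable_realfun ess_sup_inf.
Export Order.TTheory GRing.Theory Num.Theory numFieldNormedType.Exports.

Set Implicit Arguments.
Unset Strict Implicit.
Unset Printing Implicit Defensive.

Local Open Scope classical_set_scope.
Local Open Scope ring_scope.

Definition separable (X : topologicalType) : Prop :=
  exists S : set X, countable S /\ dense S.

Definition smooth2 (R : realType) (X : normedModType R) (D : R) : Prop :=
  forall x y : X,
    `|x + y| ^+ 2 + `|x - y| ^+ 2 <= 2 * `|x| ^+ 2 + 2 * D ^+ 2 * `|y| ^+ 2.

(** [borel X] is [X] with its Borel sigma-algebra. *)
Notation borel X := (g_sigma_algebraType (@open X)).

Section Bochner.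
Context {d : measure_display} {T : measurableType d} {R : realType}.
Variables (P : probability T R) (X : normedModType R).
Implicit Types (f g : T -> X) (A : set T) (G : set (set T)).

Definition random_vector f : Prop :=
  measurable_fun [set: T] (f : T -> borel X).

(** For [G] a sigma-algebra, [g_sigma_algebraType G] is [T] with [G] as its
    measurable sets. *)
Definition random_vector_wrt G f : Prop :=
  measurable_fun [set: g_sigma_algebraType G]
    (f : g_sigma_algebraType G -> borel X).

Definition simple_vector (s : T -> X) : Prop := random_vector s /\ finite_set (range s).

Definition simple_integral A (s : T -> X) : X :=
  \sum_(x \in range s) fine (P (A `&` s @^-1` [set x])) *: x.

Definition simple_approx (s_ : (T -> X)^nat) f : Prop :=
  (forall n, simple_vector (s_ n)) /\
  (\int[P]_w (`|f w - s_ n w|)%:E)%E @[n --> \oo] --> 0%E.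

Definition Bochner_integrable f : Prop :=
  random_vector f /\ exists s_ : (T -> X)^nat, simple_approx s_ f.

(** [v] is the Bochner integral of [f] over the event [A]; the limit does not
    depend on the approximating sequence. *)
Definition is_Bochner_integral A f (v : X) : Prop :=
  random_vector f /\
  exists2 s_ : (T -> X)^nat, simple_approx s_ f & simple_integral A (s_ n) @[n --> \oo] --> v.

(** [g] is a version of the conditional expectation of [f] given [G]. *)
Definition is_condexp G f g : Prop :=
  [/\ random_vector_wrt G g, Bochner_integrable g &
    forall A, G A ->
      exists2 v, is_Bochner_integral A f v & is_Bochner_integral A g v].

(** [Z] is a version of the conditional expectation given [G] of the
    [[0, +oo]]-valued random variable [Y]. *)
Definition is_condexp_ge0 G (Y Z : T -> \bar R) : Prop :=
  [/\ measurable_fun [set: g_sigma_algebraType G]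
        (Z : g_sigma_algebraType G -> \bar R),
      forall w, (0 <= Z w)%E &
      forall A, G A -> (\int[P]_(w in A) Z w = \int[P]_(w in A) Y w)%E].

Definition filtration (F : (set (set T))^nat) : Prop :=
  [/\ forall n, sigma_algebra [set: T] (F n),
      forall n, F n `<=` @measurable _ T &
      forall n, F n `<=` F n.+1].

Definition martingale (F : (set (set T))^nat) (f : (T -> X)^nat) : Prop :=
  [/\ filtration F,
      forall n, random_vector_wrt (F n) (f n),
      forall n, Bochner_integrable (f n) &
      forall n, is_condexp (F n) (f n.+1) (f n)].

(** The class M(X), for given probability space and filtration. *)
Definition martingale0 (F : (set (set T))^nat) (f : (T -> X)^nat) : Prop :=
  martingale F f /\ forall w, f 0%N w = 0.

Definition mdiff (f : (T -> X)^nat) : (T -> X)^nat :=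
  fun j w => if j is k.+1 then f k.+1 w - f k w else 0.

Definition max_norm (f : (T -> X)^nat) (w : T) : \bar R :=
  ereal_sup (range (fun j => (`|f j w|)%:E)).

(** [v j] is a version of E_(j-1) ||d_j||^2 for every j >= 1; the value of
    [v 0] is irrelevant. *)
Definition cond_variances (F : (set (set T))^nat) (f : (T -> X)^nat)
    (v : (T -> \bar R)^nat) : Prop :=
  forall j, (1 <= j)%N ->
    is_condexp_ge0 (F j.-1) (fun w => (`|mdiff f j w| ^+ 2)%:E) (v j).

Definition s2 (v : (T -> \bar R)^nat) (w : T) : \bar R :=
  sqrte (\sum_(1 <= j <oo) v j w)%E.

End Bochner.

(* Main.v *)
From HB Require Import structures.
From mathcomp Require Import finmap ring lra.
Require Import Defs.

(** The proof is the exponential supermartingale method, applied to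
    [cosh (lam * |f n|)].

    In a [(2, D)]-smooth space the squared norm has at each [x] a derivative
    that is linear in the direction ([sqn_derivD], [sqn_derivZ]) and satisfies
    the second order bound [sqn_taylor].  Combined with the triangle inequality,
    this shows that, for increments [y] with [|y| <= a],
    [[
      cosh (lam |x + y|) <= cosh (lam |x|) + l_x y
                              + cosh (lam |x|) * bennett D lam a * |y|^2
    ]]
    with [l_x] a bounded linear functional and
    [bennett D lam a = D^2 (e^(lam a) - 1 - lam a) / a^2]
    ([cosh_norm_supporting]).  The norm is never differentiated twice: since
    [cosh] is convex as a function of the square of its argument, the estimate
    reduces to a comparison of the Euclidean with the hyperbolic law of cosines
    ([cosh_law_of_cosines], [cosh_increment]).

    The martingale property makes the term [l_x] integrate to zero once [x] is
    known at the earlier time.  Cutting the probability space into countably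
    many events on which the earlier position is almost constant gives the
    conditional growth bound [cosh_step]: on the past, [cosh (lam |f (n+1)|)] is
    on average at most [cosh (lam |f n|)] times [1 + bennett D lam a * v (n+1)].
    Therefore
    [[
      expR (- bennett D lam a * (v 1 + ... + v n)) * cosh (lam |f n|)
    ]]
    is a nonnegative supermartingale starting at [1].  The sum of the [v j] is
    almost surely at most [b^2 / D^2], so Ville's inequality ([ville]) yields the
    tail bound [2 expR (bennett D lam a * b^2 / D^2 - lam r)]
    ([exponential_tail]), and the announced exponent is its value at
    [lam = ln (1 + r a / b^2) / a]. *)

Set Implicit Arguments.
Unset Strict Implicit.
Unset Printing Implicit Defensive.

Local Open Scope classical_set_scope.
Local Open Scope ring_scope.

(** * Hyperbolic functions *)

Section hyperbolic.
Context {R : realType}.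
Implicit Types x y A S : R.

Definition cosh x := (expR x + expR (- x)) / 2.
Definition sinh x := (expR x - expR (- x)) / 2.

(** The elementary inequalities below are differences that vanish at [0] and
    have a nonnegative derivative on the half-line. *)
Lemma ge0_derive_homo (f g : R -> R) : (forall x, is_derive x 1 f (g x)) ->
  (forall x, 0 <= x -> 0 <= g x) -> forall x y, 0 <= x -> x <= y -> f x <= f y.
Proof.
move=> fg g0 x y x0 xy.
apply: (@ger0_derive1_le_cc _ f x y) => //.
- move=> z; rewrite in_itv/= => /andP[xz _]; rewrite derive1E derive_val g0//.
  by rewrite (le_trans x0)// ltW.
- by apply: derivable_within_continuous.
- by rewrite in_itv/= lexx.
- by rewrite in_itv/= lexx andbT.
Qed.

Lemma ge0_derive_ge (f g : R -> R) : (forall x, is_derive x 1 f (g x)) ->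
  (forall x, 0 <= x -> 0 <= g x) -> forall x, 0 <= x -> f 0 <= f x.
Proof. by move=> fg g0 x x0; exact: (ge0_derive_homo fg g0). Qed.

Lemma is_derive_cosh x : is_derive x 1 cosh (sinh x).
Proof.
rewrite /cosh /sinh; apply: is_derive_eq; rewrite /= ?scaler0 ?add0r.
by rewrite /GRing.scale/=; field.
Qed.

Lemma is_derive_sinh x : is_derive x 1 sinh (cosh x).
Proof.
rewrite /cosh /sinh; apply: is_derive_eq; rewrite /= ?scaler0 ?add0r.
by rewrite /GRing.scale/=; field.
Qed.

Lemma cosh_ge1 x : 1 <= cosh x.
Proof.
by rewrite /cosh; have := expR_ge1Dx x; have := expR_ge1Dx (- x); lra.
Qed.

Lemma coshN x : cosh (- x) = cosh x.
Proof. by rewrite /cosh opprK addrC. Qed.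

Lemma sinhN x : sinh (- x) = - sinh x.
Proof. by rewrite /sinh opprK -mulNr opprB. Qed.

Lemma sinh0 : sinh 0 = 0. Proof. by rewrite /sinh oppr0 subrr mul0r. Qed.

Lemma sinh_ge_id x : 0 <= x -> x <= sinh x.
Proof.
move=> x0.
have H y : is_derive y 1 (fun y => sinh y - y) (cosh y - 1).
  by have := is_derive_sinh y => ?; apply: is_derive_eq.
have := ge0_derive_ge H _ x0; rewrite sinh0 subr0 subr_ge0; apply.
by move=> y _; rewrite subr_ge0 cosh_ge1.
Qed.

Lemma sinh_ge0 x : 0 <= x -> 0 <= sinh x.
Proof. by move=> x0; rewrite (le_trans x0)// sinh_ge_id. Qed.

Lemma sinh_le_cosh x : sinh x <= cosh x.
Proof. by rewrite /cosh/sinh; have := expR_ge0 (- x); lra. Qed.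

Lemma sinh_le_Mcosh x : 0 <= x -> sinh x <= x * cosh x.
Proof.
move=> x0.
have H y : is_derive y 1 (fun y => y * cosh y - sinh y) (y * sinh y).
  have ? := is_derive_sinh y; have ? := is_derive_cosh y; apply: is_derive_eq.
  by rewrite /GRing.scale/= mulr1; ring.
have := ge0_derive_ge H _ x0; rewrite sinh0 mul0r subr0 subr_ge0; apply.
by move=> y y0; rewrite mulr_ge0// (le_trans y0)// sinh_ge_id.
Qed.

Lemma le_cosh x y : 0 <= x -> x <= y -> cosh x <= cosh y.
Proof.
by move=> x0 xy; apply: (ge0_derive_homo is_derive_cosh) => // z; exact: sinh_ge0.
Qed.

Lemma coshD x y : cosh (x + y) = cosh x * cosh y + sinh x * sinh y.
Proof. by rewrite /cosh /sinh opprD !expRD; field. Qed.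

(** [ln cosh] is 1-Lipschitz: replacing a point by a nearby one costs a factor
    close to one. *)
Lemma cosh_shift (u v e : R) : 0 <= u -> u <= v + e -> 0 <= v -> 0 <= e ->
  cosh u <= expR e * cosh v.
Proof.
move=> u0 uv v0 e0; rewrite (le_trans (le_cosh u0 uv))//.
rewrite /cosh mulrA mulrDr -!expRD ler_pM2r ?invr_gt0//.
by rewrite (addrC e v) lerD2l ler_expR; lra.
Qed.

Lemma expR_ge_quad x : 0 <= x -> x ^+ 2 / 2 <= expR x - 1 - x.
Proof.
move=> x0.
have H y : is_derive y 1 (fun y => expR y - 1 - y - y ^+ 2 / 2) (expR y - 1 - y).
  by apply: is_derive_eq; rewrite /GRing.scale/=; field.
have := ge0_derive_ge H _ x0; rewrite expR0 expr0n/= mul0r !subr0 subrr subr_ge0.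
by apply => y _; have := expR_ge1Dx y; lra.
Qed.

(** [(expR x - 1 - x) / x ^+ 2] is nondecreasing.  With [t := x / y] the
    difference, as a function of [y], vanishes to first order at [0] and has
    second derivative [t ^+ 2 * (expR y - expR (t * y))]. *)
Lemma expR_sub_le (x y : R) : 0 < y -> 0 <= x -> x <= y ->
  expR x - 1 - x <= (expR y - 1 - y) / y ^+ 2 * x ^+ 2.
Proof.
move=> y0 x0 xy; pose t := x / y.
have t0 : 0 <= t by rewrite divr_ge0// ltW.
have t1 : t <= 1 by rewrite ler_pdivrMr// mul1r.
have dexp (z : R) : is_derive z 1 (fun z => expR (t * z)) (t * expR (t * z)).
  have ? : is_derive z 1 (fun z => t * z) t.
    by apply: is_derive_eq; rewrite /GRing.scale/= mulr1.
  apply: (is_derive_eq (@is_derive1_comp _ expR (fun z => t * z) z _ _ _ _)).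
  by rewrite mulrC.
have H2 (z : R) : 0 <= z -> 0 <= t ^+ 2 * (expR z - 1) - t * (expR (t * z) - 1).
  move=> z0.
  have H (w : R) : is_derive w 1 (fun w => t ^+ 2 * (expR w - 1) - t * (expR (t * w) - 1))
      (t ^+ 2 * (expR w - expR (t * w))).
    by have ? := dexp w; apply: is_derive_eq; rewrite /GRing.scale/=; ring.
  have := ge0_derive_ge H _ z0; rewrite mulr0 expR0 subrr !mulr0 subr0; apply.
  move=> w w0; rewrite mulr_ge0 ?sqr_ge0// subr_ge0 ler_expR.
  by rewrite ler_piMl.
have H (z : R) : is_derive z 1 (fun z => t ^+ 2 * (expR z - 1 - z) - (expR (t * z) - 1 - t * z))
      (t ^+ 2 * (expR z - 1) - t * (expR (t * z) - 1)).
  by have ? := dexp z; apply: is_derive_eq; rewrite /GRing.scale/=; ring.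
have /= := ge0_derive_ge H H2 (ltW y0).
rewrite !mulr0 expR0 subr0 subrr mulr0 !subr0 subr_ge0.
rewrite /t divfK ?gt_eqF// => /le_trans; apply.
by rewrite le_eqVlt; apply/orP; left; apply/eqP; field; rewrite gt_eqF.
Qed.

Lemma convex_exprn (t p q : R) n : 0 <= t <= 1 -> 0 <= p -> 0 <= q ->
  ((1 - t) * p + t * q) ^+ n <= (1 - t) * p ^+ n + t * q ^+ n.
Proof.
move=> /andP[t0 t1] p0 q0; elim: n => [|n IH]; first by rewrite !expr0; lra.
set m := (1 - t) * p + t * q.
have m0 : 0 <= m by rewrite /m addr_ge0// mulr_ge0// subr_ge0.
rewrite exprS (le_trans (ler_wpM2l m0 IH))// -subr_ge0 !exprS.
rewrite (_ : _ - _ = (1 - t) * t * ((p - q) * (p ^+ n - q ^+ n))); last first.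
  by rewrite /m; ring.
apply: mulr_ge0; first by rewrite mulr_ge0 ?subr_ge0.
have [pq|qp] := leP p q.
  by rewrite mulr_le0// subr_le0// lerXn2r.
by rewrite mulr_ge0// subr_ge0 ?lerXn2r// ltW.
Qed.

(** [cosh] is a convex function of the square of its argument, because every
    term [x ^+ (2 * k) / (2 * k)!] of its series is one. *)
Lemma cosh_convex_sqr (t u v w : R) : 0 <= t <= 1 ->
  w ^+ 2 = (1 - t) * u ^+ 2 + t * v ^+ 2 ->
  cosh w <= (1 - t) * cosh u + t * cosh v.
Proof.
move=> t01 wE.
(* twice the partial sums of the series of cosh *)
pose c (x : R) := series (exp_coeff x) \+ series (exp_coeff (- x)).
have cc x : c x n @[n --> \oo] --> 2 * cosh x.
  rewrite /cosh mulrC divfK//; apply: cvgD; exact: is_cvg_series_exp_coeff.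
have : 2 * cosh w <= (1 - t) * (2 * cosh u) + t * (2 * cosh v); last lra.
have cr : ((1 - t) * c u n + t * c v n) @[n --> \oo] --> (1 - t) * (2 * cosh u) + t * (2 * cosh v).
  by apply: cvgD; apply: cvgMr; exact: cc.
apply: (ler_cvg_to (cc w) cr); apply: nearW => n.
rewrite /c/= /series/= -!big_split/= !mulr_sumr -big_split/=.
apply: ler_sum => k _; rewrite /exp_coeff/= -!mulrDl !mulrA -mulrDl.
rewrite ler_wpM2r ?invr_ge0//.
have [ok|/negPf ek] := boolP (odd k).
  by rewrite (exprNn w) (exprNn u) (exprNn v) -signr_odd ok expr1 !mulN1r !subrr !mulr0 addr0.
rewrite (exprNn w) (exprNn u) (exprNn v) -signr_odd ek expr0 !mul1r.
rewrite -[k]odd_double_half ek add0n -muln2 mulnC !exprM wE.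
by have := convex_exprn k./2 t01 (sqr_ge0 u) (sqr_ge0 v); lra.
Qed.

(** Toponogov-type comparison: with [th] minus the cosine of the angle, the
    third side [w] of a Euclidean triangle with sides [A] and [S] is at most the
    third side of the hyperbolic triangle with the same data.  By convexity in
    [w ^+ 2] it is a chord inequality between the degenerate triangles
    [A - S] and [A + S]. *)
Lemma cosh_law_of_cosines (A S w th : R) : -1 <= th <= 1 ->
  w ^+ 2 = A ^+ 2 + S ^+ 2 + 2 * A * S * th ->
  cosh w <= cosh A * cosh S + th * sinh A * sinh S.
Proof.
move=> th1 wE.
have := @cosh_convex_sqr ((1 + th) / 2) (A - S) (A + S) w.
rewrite (coshD A S) (coshD A (- S)) coshN sinhN.
move=> H; apply: (le_trans (H _ _)); first lra.
  by rewrite wE; field.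
by rewrite le_eqVlt; apply/orP; left; apply/eqP; field.
Qed.

(** The scalar form of the one-step estimate.  Here [A], [S], [w] stand for the
    rescaled norms of [x], [y], [x + y], [g] for the rescaled derivative of the
    squared norm at [x] along [y], and [K] for the square of the smoothness
    constant.  For [K > 1] the quadratic bound on [w] alone would be useless: for
    large [S], [cosh (sqrt K * S)] exceeds any multiple of [expR S].  The
    triangle inequality makes [th] in [cosh_law_of_cosines] an admissible cosine,
    and the quadratic bound then serves only to bound [th] from above, linearly
    in [g] and [K]. *)
Lemma cosh_increment (A S w g K : R) : 0 < A -> 0 <= S -> 1 <= K ->
  0 <= w -> `|A - S| <= w -> w <= A + S ->
  w ^+ 2 <= A ^+ 2 + g + K * S ^+ 2 ->
  cosh w <= cosh A + sinh A / (2 * A) * g + K * cosh A * (expR S - 1 - S).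
Proof.
move=> A0 S0 K1 w0 wl wu wq.
have cA := cosh_ge1 A; have sA := sinh_ge0 (ltW A0).
have eS : 0 <= expR S - 1 - S by have := expR_ge1Dx S; lra.
have sAA : sinh A / A <= cosh A by rewrite ler_pdivrMr// mulrC sinh_le_Mcosh// ltW.
have sAA0 : 0 <= sinh A / A by rewrite divr_ge0// ltW.
have sAgE : sinh A / (2 * A) * g = sinh A / A * g / 2 by field; rewrite gt_eqF.
move: S0; rewrite le_eqVlt => /predU1P[S0|S0].
  rewrite -S0 expr0n/= mulr0 expR0 !subr0 subrr mulr0 !addr0 in wq wl wu *.
  have wA : w = A by apply/le_anti; rewrite wu; move: wl; rewrite gtr0_norm.
  rewrite wA lerDl sAgE; rewrite wA in wq.
  by rewrite mulr_ge0// mulr_ge0//; lra.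
pose th := (w ^+ 2 - A ^+ 2 - S ^+ 2) / (2 * A * S).
have AS0 : 0 < 2 * A * S by rewrite !mulr_gt0.
have thE : 2 * A * S * th = w ^+ 2 - A ^+ 2 - S ^+ 2.
  by rewrite /th mulrC divfK// gt_eqF.
have w2l : (A - S) ^+ 2 <= w ^+ 2 by rewrite -(real_normK (num_real (A - S))) lerXn2r// nnegrE.
have w2u : w ^+ 2 <= (A + S) ^+ 2 by rewrite lerXn2r// nnegrE// addr_ge0// ltW.
have th1 : -1 <= th <= 1.
  rewrite /th ler_pdivlMr// ler_pdivrMr//; apply/andP; split; nra.
have := @cosh_law_of_cosines A S w th th1 _.
rewrite thE => H; apply: (le_trans (H _)); first by ring.
have sS := sinh_ge_id (ltW S0).
have eSE : cosh S - 1 + (sinh S - S) = expR S - 1 - S by rewrite /cosh/sinh; lra.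
(* second and higher order terms, where only |th| <= 1 matters *)
have step1 : cosh A * (cosh S - 1) + th * sinh A * (sinh S - S)
    <= cosh A * (expR S - 1 - S).
  rewrite -eSE (mulrDr (cosh A) (cosh S - 1)) lerD2l ler_wpM2r ?subr_ge0//.
  by rewrite (le_trans _ (sinh_le_cosh A))// ler_piMl//; case/andP: th1.
(* first order term: the excess K - 1 contributes at order S ^+ 2 *)
have step2 : th * sinh A * S <= sinh A / A * g / 2 + (K - 1) * cosh A * (expR S - 1 - S).
  have -> : th * sinh A * S = sinh A / A * ((2 * A * S * th) / 2) by field; rewrite gt_eqF.
  apply: (@le_trans _ _ (sinh A / A * ((g + (K - 1) * S ^+ 2) / 2))).
    by rewrite ler_wpM2l// ler_pM2r ?invr_gt0// thE; lra.
  rewrite mulrDl mulrDr mulrA lerD2l.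
  rewrite -(mulrA (K - 1)) mulrCA -(mulrA (K - 1)) ler_wpM2l ?subr_ge0//.
  by apply: ler_pM => //; rewrite ?expR_ge_quad ?mulr_ge0 ?sqr_ge0// ltW.
rewrite sAgE; nra.
Qed.

End hyperbolic.

(** * The derivative of the squared norm in a smooth space *)

Section norm_derivative.
Context {R : realType} {X : normedModType R}.
Implicit Types (x y z : X) (s t c D : R).

Definition sqn_quot x y t := (`|x + t *: y| ^+ 2 - `|x| ^+ 2) / t.

(** The right derivative at [x] of the squared norm in the direction [y]:
    by convexity the difference quotients decrease to it as [t] decreases to
    [0], so that an infimum can replace the limit. *)
Definition sqn_deriv x y := inf (sqn_quot x y @` [set t | 0 < t]).

Lemma sqn_convex x y t : 0 <= t <= 1 ->
  `|(1 - t) *: x + t *: y| ^+ 2 <= (1 - t) * `|x| ^+ 2 + t * `|y| ^+ 2.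
Proof.
move=> t01; have /andP[t0 t1] := t01.
apply: le_trans (convex_exprn 2 t01 (normr_ge0 x) (normr_ge0 y)).
rewrite lerXn2r ?nnegrE//; first by rewrite addr_ge0// mulr_ge0// subr_ge0.
by rewrite (le_trans (ler_normD _ _))// !normrZ ger0_norm ?subr_ge0// (ger0_norm t0).
Qed.

Lemma le_sqn_quot x y s t : 0 < s -> s <= t -> sqn_quot x y s <= sqn_quot x y t.
Proof.
move=> s0 st; have t0 := lt_le_trans s0 st.
have h : 0 <= s / t <= 1.
  by rewrite ler_pdivrMr// mul1r st divr_ge0// ltW.
have := sqn_convex x (x + t *: y) h.
rewrite scalerDr scalerA divfK ?gt_eqF// addrA -scalerDl subrK scale1r => H.
rewrite /sqn_quot ler_pdivrMr//.
have -> : (`|x + t *: y| ^+ 2 - `|x| ^+ 2) / t * s =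
  (s / t) * `|x + t *: y| ^+ 2 - (s / t) * `|x| ^+ 2 by field; rewrite gt_eqF.
lra.
Qed.

(** Makes the infimum defining [sqn_deriv] finite. *)
Lemma sqn_quot_ge x y t : 0 < t -> - (2 * `|x| * `|y|) <= sqn_quot x y t.
Proof.
move=> t0; rewrite /sqn_quot ler_pdivlMr//.
have := ler_normD (x + t *: y) (- (t *: y)).
rewrite addrK normrN normrZ gtr0_norm//.
have := normr_ge0 x; have := normr_ge0 (x + t *: y).
have : 0 <= t * `|y| by rewrite mulr_ge0// ltW.
set m := `|_ + _|; set n := `|x|; have -> : 2 * n * `|y| = 2 * (n * `|y|) by ring.
rewrite -mulNr -mulrA (_ : n * `|y| * t = n * (t * `|y|)); last ring.
set u := t * `|y| => u0 m0 n0 nmu; have [un|nu] := leP u n; nra.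
Qed.

Lemma sqn_deriv_le x y t : 0 < t -> sqn_deriv x y <= sqn_quot x y t.
Proof.
move=> t0; apply: ge_inf; last by exists t.
by exists (- (2 * `|x| * `|y|)) => _ [s s0 <-]; exact: sqn_quot_ge.
Qed.

Lemma sqn_deriv_ge x y c : (forall t, 0 < t -> c <= sqn_quot x y t) ->
  c <= sqn_deriv x y.
Proof.
move=> h; apply: lb_le_inf; first by exists (sqn_quot x y 1), 1 => /=.
by move=> _ [t t0 <-]; exact: h.
Qed.

(** By monotonicity the infimum is approached along all small parameters, which
    lets two directions be compared at a common one. *)
Lemma sqn_deriv_lt x y e : 0 < e ->
  exists2 t, 0 < t & forall s, 0 < s -> s <= t -> sqn_quot x y s < sqn_deriv x y + e.
Proof.
move=> e0.
have [|_ [t t0 <-] h] := @inf_adherent _ (sqn_quot x y @` [set t | 0 < t]) e e0.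
  split; first by exists (sqn_quot x y 1), 1 => /=.
  by exists (- (2 * `|x| * `|y|)) => _ [s s0 <-]; exact: sqn_quot_ge.
exists t => // s s0 st; exact: le_lt_trans (le_sqn_quot x y s0 st) h.
Qed.

Lemma sqn_derivZ_gt0 x y c : 0 < c -> sqn_deriv x (c *: y) = c * sqn_deriv x y.
Proof.
move=> c0.
have E t : 0 < t -> sqn_quot x (c *: y) t = c * sqn_quot x y (t * c).
  by move=> t0; rewrite /sqn_quot scalerA; field; rewrite !gt_eqF.
apply/le_anti/andP; split.
  rewrite -ler_pdivrMl//; apply: sqn_deriv_ge => t t0.
  rewrite ler_pdivrMl//.
  have tc0 : 0 < t / c by rewrite divr_gt0.
  by have := sqn_deriv_le x (c *: y) tc0; rewrite E// divfK// gt_eqF.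
apply: sqn_deriv_ge => t t0; rewrite E// ler_pM2l//.
by apply: sqn_deriv_le; rewrite mulr_gt0.
Qed.

(** Midpoint convexity: half of [u *: (y + z)] is the midpoint of [u *: y] and
    [u *: z]. *)
Lemma sqn_derivD_le x y z : sqn_deriv x (y + z) <= sqn_deriv x y + sqn_deriv x z.
Proof.
apply/ler_addgt0Pr => e e0.
have e2 : 0 < e / 2 by rewrite divr_gt0.
have [t t0 ht] := sqn_deriv_lt x y e2.
have [s s0 hs] := sqn_deriv_lt x z e2.
pose u := Num.min s t.
have u0 : 0 < u by rewrite lt_min s0.
have /ht {}ht := u0; have /hs {}hs := u0.
have : sqn_quot x (y + z) (u / 2) <= sqn_quot x y u + sqn_quot x z u.
  have h : 0 <= (1 / 2 : R) <= 1 by lra.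
  have := sqn_convex (x + u *: y) (x + u *: z) h.
  have -> : (1 - 1 / 2) *: (x + u *: y) + (1 / 2) *: (x + u *: z) =
     x + (u / 2) *: (y + z).
    rewrite (_ : 1 - 1/2 = 1/2); last by field.
    rewrite !scalerDr addrACA -scalerDl (_ : 1 / 2 + 1 / 2 = 1); last by field.
    by rewrite scale1r !scalerA (_ : 1 / 2 * u = u / 2)//; field.
  move=> H; rewrite /sqn_quot -mulrDl ler_pdivrMr ?divr_gt0//.
  rewrite (_ : _ / u * (u / 2) = ((`|x + u *: y| ^+ 2 - `|x| ^+ 2) + (`|x + u *: z| ^+ 2 - `|x| ^+ 2)) / 2); last first.
    by field; rewrite gt_eqF.
  lra.
have : sqn_deriv x (y + z) <= sqn_quot x (y + z) (u / 2).
  by apply: sqn_deriv_le; rewrite divr_gt0.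
have : u <= t by rewrite ge_min lexx orbT.
have : u <= s by rewrite ge_min lexx.
move=> /hs + /ht; lra.
Qed.

Section smooth.
Context (D : R) (hD : smooth2 X D).

(** Smoothness bounds the sum of the quotients along [y] and [- y] by a multiple
    of [t], so the right and left derivatives agree; with subadditivity this
    makes [sqn_deriv x] linear. *)
Lemma sqn_derivN x y : sqn_deriv x (- y) = - sqn_deriv x y.
Proof.
have d0 : 0 <= sqn_deriv x 0.
  by apply: sqn_deriv_ge => t t0; rewrite /sqn_quot scaler0 addr0 subrr mul0r.
apply/le_anti/andP; split; last first.
  have := sqn_derivD_le x y (- y); rewrite subrr; lra.
suff : sqn_deriv x y + sqn_deriv x (- y) <= 0 by lra.
apply/ler_addgt0Pr => e e0; rewrite add0r.
pose q := 2 * D ^+ 2 * `|y| ^+ 2.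
have q0 : 0 <= q by rewrite mulr_ge0 ?sqr_ge0// mulr_ge0// sqr_ge0.
pose t := e / (1 + q).
have t0 : 0 < t by rewrite divr_gt0//; lra.
have := hD x (t *: y); rewrite normrZ gtr0_norm// => H.
have := sqn_deriv_le x y t0; have := sqn_deriv_le x (- y) t0.
have : sqn_quot x y t + sqn_quot x (- y) t <= e; last lra.
rewrite /sqn_quot -mulrDl ler_pdivrMr// scalerN.
have tq : e = t + t * q by rewrite /t; field; rewrite gt_eqF//; lra.
rewrite {}tq mulrDl; have -> : t * q * t = 2 * D ^+ 2 * (t * `|y|) ^+ 2 by rewrite /q; ring.
have : 0 <= t * t by rewrite -expr2 sqr_ge0.
by lra.
Qed.

Lemma sqn_derivD x y z : sqn_deriv x (y + z) = sqn_deriv x y + sqn_deriv x z.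
Proof.
apply/le_anti; rewrite sqn_derivD_le/=.
have := sqn_derivD_le x (y + z) (- z).
by rewrite addrK sqn_derivN; lra.
Qed.

Lemma sqn_derivZ x y c : sqn_deriv x (c *: y) = c * sqn_deriv x y.
Proof.
have [c0|c0|->] := ltgtP c 0; last 2 first.
- exact: sqn_derivZ_gt0.
- rewrite scale0r mul0r; have := sqn_derivD x 0 0; rewrite addr0; lra.
rewrite -[c]opprK scaleNr sqn_derivN sqn_derivZ_gt0 ?oppr_gt0//.
by ring.
Qed.

Lemma sqn_deriv_norm x y : `|sqn_deriv x y| <= 2 * `|x| * `|y|.
Proof.
have H z : - (2 * `|x| * `|z|) <= sqn_deriv x z.
  by apply: sqn_deriv_ge => t; exact: sqn_quot_ge.
rewrite ler_norml H/=.
have := H (- y); rewrite sqn_derivN normrN; lra.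
Qed.

(** Smoothness at the centre [x + t *: y].  Each halving of the step costs half
    as much as the preceding one; the total cost is what gives the sharp constant
    [D ^+ 2] in [sqn_taylor]. *)
Lemma sqn_quot_double x y t : 0 < t ->
  sqn_quot x y (2 * t) <= sqn_quot x y t + D ^+ 2 * t * `|y| ^+ 2.
Proof.
move=> t0; rewrite /sqn_quot ler_pdivrMr ?mulr_gt0//.
have -> : ((`|x + t *: y| ^+ 2 - `|x| ^+ 2) / t + D ^+ 2 * t * `|y| ^+ 2) * (2 * t) =
  2 * (`|x + t *: y| ^+ 2 - `|x| ^+ 2) + 2 * D ^+ 2 * (t * `|y|) ^+ 2.
  by field; rewrite gt_eqF.
have := hD (x + t *: y) (t *: y).
rewrite addrK -addrA -scalerDl normrZ gtr0_norm// (_ : t + t = 2 * t); last ring.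
lra.
Qed.

Lemma sqn_taylor x y :
  `|x + y| ^+ 2 <= `|x| ^+ 2 + sqn_deriv x y + D ^+ 2 * `|y| ^+ 2.
Proof.
have H n : sqn_quot x y 1 <= sqn_quot x y (2 ^- n) + D ^+ 2 * `|y| ^+ 2 * (1 - 2 ^- n).
  elim: n => [|n IH]; first by rewrite expr0 invr1 subrr mulr0 addr0.
  have p0 : 0 < 2 ^- n.+1 :> R by rewrite invr_gt0 exprn_gt0.
  have := sqn_quot_double x y p0.
  have E : 2 * 2 ^- n.+1 = 2 ^- n :> R.
    by rewrite exprS; field; rewrite expf_neq0.
  rewrite E; move: IH; rewrite -E; nra.
apply/ler_addgt0Pr => e e0.
have [t t0 ht] := sqn_deriv_lt x y e0.
have [n hn] : exists n, 2 ^- n <= t.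
  have : (fun n => (2^-1 : R) ^+ n) @ \oo --> 0.
    by apply: cvg_expr; rewrite ger0_norm//; lra.
  move/cvgrPdist_le => /(_ t t0)[n _ /(_ n (leqnn n))].
  rewrite sub0r normrN ger0_norm ?exprn_ge0// exprVn => ?.
  by exists n.
have p0 : 0 < 2 ^- n :> R by rewrite invr_gt0 exprn_gt0.
have := ht _ p0 hn; have := H n; rewrite {1}/sqn_quot scale1r divr1.
have : 0 <= D ^+ 2 * `|y| ^+ 2 * 2 ^- n by rewrite mulr_ge0 ?(ltW p0)// mulr_ge0// sqr_ge0.
lra.
Qed.

(** The space must be nontrivial: on [{0}] every [D] is admissible. *)
Lemma smooth2_ge1 y : y != 0 -> 1 <= D ^+ 2.
Proof.
move=> y0; have := hD 0 y; rewrite add0r sub0r normrN normr0 expr0n/= mulr0 add0r.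
have : 0 < `|y| ^+ 2 by rewrite exprn_gt0// normr_gt0.
nra.
Qed.

End smooth.
End norm_derivative.

(** * Second order bound for the hyperbolic cosine of the norm *)

Section pointwise.
Context {R : realType} {X : normedModType R}.
Implicit Types (x y : X) (D lam a : R).

(** The growth rate of [cosh (lam * |f|)] per unit of conditional
    variance when the increments are at most [a]. *)
Definition bennett D lam a := D ^+ 2 * ((expR (lam * a) - 1 - lam * a) / a ^+ 2).

Lemma bennett_ge0 D lam a : 0 <= bennett D lam a.
Proof.
rewrite mulr_ge0 ?sqr_ge0// divr_ge0 ?sqr_ge0//.
by have := expR_ge1Dx (lam * a); lra.
Qed.

Lemma cosh_norm_le D lam a x y : smooth2 X D -> 0 < lam -> 0 < a -> `|y| <= a ->
  cosh (lam * `|x + y|) <= cosh (lam * `|x|)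
    + sinh (lam * `|x|) / (2 * `|x|) * lam * sqn_deriv x y
    + cosh (lam * `|x|) * bennett D lam a * `|y| ^+ 2.
Proof.
move=> hD l0 a0 ya.
have [->|y0] := eqVneq y 0.
  rewrite addr0 normr0 expr0n/= mulr0 addr0.
  by have := sqn_derivZ hD x 0 0; rewrite scale0r mul0r => ->; rewrite mulr0 addr0.
have D1 := smooth2_ge1 hD y0.
have S0 : 0 <= lam * `|y| by rewrite mulr_ge0// ltW.
have Sa : lam * `|y| <= lam * a by rewrite ler_pM2l.
have la0 : 0 < lam * a by rewrite mulr_gt0.
have := expR_sub_le la0 S0 Sa.
rewrite (_ : _ / _ * (lam * `|y|) ^+ 2 =
  (expR (lam * a) - 1 - lam * a) / a ^+ 2 * `|y| ^+ 2); last first.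
  by field; rewrite !gt_eqF.
set k := _ * `|y| ^+ 2 => hk.
have -> : cosh (lam * `|x|) * bennett D lam a * `|y| ^+ 2 =
  D ^+ 2 * cosh (lam * `|x|) * k by rewrite /bennett /k; ring.
have c1 := cosh_ge1 (lam * `|x|).
have Dc0 : 0 <= D ^+ 2 * cosh (lam * `|x|) by rewrite mulr_ge0 ?sqr_ge0// (le_trans ler01).
have := ler_wpM2l Dc0 hk.
(* the norm is not differentiable at 0, but there the first order term vanishes
   and cosh - 1 <= expR - 1 - id suffices *)
have [->|x0] := eqVneq x 0.
  rewrite add0r normr0 mulr0 sinh0 !mul0r addr0.
  have -> : cosh 0 = 1 :> R by rewrite /cosh oppr0 expR0; field.
  rewrite mulr1 => /(le_trans _) H; rewrite addrC -lerBlDr; apply: H.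
  have e0 : 0 <= expR (lam * `|y|) - 1 - lam * `|y|.
    by have := expR_ge1Dx (lam * `|y|); lra.
  apply: le_trans (ler_peMl e0 D1).
  by have := sinh_ge_id S0; rewrite /cosh /sinh; lra.
move=> H; apply: (@le_trans _ _ (cosh (lam * `|x|) + sinh (lam * `|x|) / (2 * `|x|) * lam * sqn_deriv x y + D ^+ 2 * cosh (lam * `|x|) * (expR (lam * `|y|) - 1 - lam * `|y|))); last first.
  by rewrite lerD2l.
have nx0 : 0 < `|x| by rewrite normr_gt0.
have A0 : 0 < lam * `|x| by rewrite mulr_gt0.
have -> : sinh (lam * `|x|) / (2 * `|x|) * lam * sqn_deriv x y =
  sinh (lam * `|x|) / (2 * (lam * `|x|)) * (lam ^+ 2 * sqn_deriv x y).
  by field; rewrite !gt_eqF.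
apply: cosh_increment => //.
- by rewrite mulr_ge0// ltW.
- rewrite -mulrBr normrM gtr0_norm// ler_pM2l//.
  exact: ler_dist_normD.
- by rewrite -mulrDr ler_pM2l// ler_normD.
- rewrite !exprMn (mulrCA (D ^+ 2)) -!mulrDr ler_pM2l ?exprn_gt0//.
  exact: sqn_taylor.
Qed.

(** What the martingale property needs from [cosh_norm_le]: the first order term
    is a bounded linear functional of the increment. *)
Lemma cosh_norm_supporting D lam a x : smooth2 X D -> 0 < lam -> 0 < a ->
  exists l : {linear X -> R^o}, (exists C, forall y, `|l y| <= C * `|y|) /\
  forall y, `|y| <= a ->
  cosh (lam * `|x + y|) <= cosh (lam * `|x|) + l y
    + cosh (lam * `|x|) * bennett D lam a * `|y| ^+ 2.
Proof.
move=> hD l0 a0.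
pose c := sinh (lam * `|x|) / (2 * `|x|) * lam.
pose f : X -> R^o := fun y => c * sqn_deriv x y.
have lf : linear f.
  move=> k y z; rewrite /f (sqn_derivD hD) (sqn_derivZ hD) mulrDr; congr (_ + _).
  by rewrite /GRing.scale/= mulrCA.
pose l : {linear X -> R^o} := HB.pack f (GRing.isLinear.Build _ _ _ _ f lf).
exists l; split; last by move=> y ya; exact: cosh_norm_le.
exists (`|c| * (2 * `|x|)) => y; rewrite /l/= /f normrM -mulrA.
by rewrite ler_wpM2l// (sqn_deriv_norm hD).
Qed.

End pointwise.

(** * Random vectors and Bochner integrals *)

Section random_vectors.
Context {d : measure_display} {T : measurableType d} {R : realType}
  {X : normedModType R}.
Implicit Types (f g : T -> borel X).

Lemma separable_seq : separable X ->
  exists u : nat -> X, forall x e, 0 < e -> exists n, `|x - u n| < e.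
Proof.
move=> [S [/countable_injP[h hinj] dS]].
exists (fun n => xget 0 [set x | S x /\ h x = n]) => x e e0.
have [y [xy Sy]] : ball x e `&` S !=set0.
  by apply: dS; [exists x; exact: ballxx|exact: ball_open].
exists (h y); case: xgetP => [z zE [Sz hz]|/(_ y)]; last by case.
by rewrite (hinj z y) ?inE// -ball_normE in xy *.
Qed.

Lemma measurable_continuous_comp f (phi : X -> R) :
  measurable_fun [set: T] f -> continuous phi ->
  measurable_fun [set: T] (phi \o f).
Proof.
move=> mf cphi; apply: (measurability _ (RGenOpens.measurableE R)) => _ [_ [a [b ->]] <-].
rewrite setTI comp_preimage -[_ @^-1` _]setTI; apply: mf => //.
by apply: sub_sigma_algebra; move/continuousP: cphi; apply; exact: interval_open.
Qed.

Lemma measurable_norm_subr f (x : X) :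
  measurable_fun [set: T] f -> measurable_fun [set: T] (fun w => `|(f w : X) - x|).
Proof.
move=> mf; apply: (@measurable_continuous_comp f (fun y => `|y - x|)) => // y.
by apply: (@continuous_comp _ _ _ (fun y => y - x) Num.norm);
  [apply: cvgB; [exact: cvg_id|exact: cvg_cst]|exact: norm_continuous].
Qed.

(** Composing the pair [(f, g)] with the continuous distance would require the
    Borel sigma-algebra of the product to be the product sigma-algebra.
    Instead, separability makes the distance the supremum of
    [|f - u k| - |g - u k|] over a dense sequence [u]. *)
Lemma measurable_norm_sub f g : separable X ->
  measurable_fun [set: T] f -> measurable_fun [set: T] g ->
  measurable_fun [set: T] (fun w => `|(f w : X) - g w|).
Proof.
move=> /separable_seq[u hu] mf mg.
apply: (measurability _ (RGenOInfty.measurableE R)) => _ [_ [c ->] <-].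
rewrite setTI [X in measurable X](_ : _ =
    \bigcup_k [set w | c < `|(f w : X) - u k| - `|(g w : X) - u k|]).
  apply: bigcupT_measurable => k; rewrite -[X in measurable X]setTI.
  rewrite [X in _ `&` X](_ : _ = (fun w => `|(f w : X) - u k| - `|(g w : X) - u k|) @^-1` `]c, +oo[).
    by apply: measurable_funB => //; exact: measurable_norm_subr.
  by apply/seteqP; split => w /=; rewrite in_itv/= andbT.
apply/seteqP; split => w /=; rewrite in_itv/= andbT.
  move=> cfg; have e0 : 0 < (`|(f w : X) - g w| - c) / 2.
    by rewrite divr_gt0// subr_gt0.
  have [n hn] := hu (g w) _ e0; exists n => //=.
  have := ler_normD ((f w : X) - u n) (u n - g w); rewrite addrA subrK.
  rewrite (distrC (u n)); lra.
move=> [k _ /= /lt_le_trans]; apply.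
by rewrite lerBlDr; have := ler_normD ((f w : X) - g w) (g w - u k); rewrite addrA subrK.
Qed.

Lemma measurable_vector_set1 f (x : X) :
  measurable_fun [set: T] f -> measurable (f @^-1` [set x]).
Proof.
move=> mf; rewrite -[_ @^-1` _]setTI; apply: mf => //.
rewrite -[[set x]]setCK; apply: (@sigma_algebraC X).
apply: sub_sigma_algebra; apply: closed_openC; apply: accessible_closed_set1.
exact: hausdorff_accessible (@norm_hausdorff _ X).
Qed.

End random_vectors.

Section bochner.
Context {d : measure_display} {T : measurableType d} {R : realType}
  (P : probability T R) {X : normedModType R}.
Implicit Types (f s : T -> X) (A : set T).

Lemma simple_vector_bounded s : simple_vector s -> exists M, forall w, `|s w| <= M.
Proof.
move=> [_ /finite_seqP[r rE]]; exists (\sum_(x <- r) `|x|) => w.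
have : [set` r] (s w) by rewrite -rE; exists w.
by move=> /= swr; rewrite (big_rem (s w))//= lerDl sumr_ge0.
Qed.

Lemma bounded_functional_continuous (l : {linear X -> R^o}) C :
  (forall y, `|l y| <= C * `|y|) -> continuous l.
Proof.
move=> lC; apply/linear_bounded_continuous/linear_boundedP.
exists (C + 1); split; first exact: num_real.
move=> y Cy z; rewrite (le_trans (lC z))// ler_wpM2r//; lra.
Qed.

Lemma Bochner_integrable_norm f : separable X -> Bochner_integrable P f ->
  P.-integrable [set: T] (fun w => (`|f w|)%:E).
Proof.
move=> hsep [mf [s [ss /fine_cvgP[+ _]]]] => -[n _ /(_ n (leqnn n)) fsn].
have [M sM] := simple_vector_bounded (ss n).
have mfs : measurable_fun [set: T] (fun w => `|f w - s n w|).
  by apply: measurable_norm_sub => //; case: (ss n).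
have mnf : measurable_fun [set: T] (fun w => `|f w|).
  exact: (measurable_continuous_comp mf (@norm_continuous _ X)).
have ig : P.-integrable [set: T] (fun w => (`|f w - s n w|)%:E + M%:E)%E.
  apply: integrableD => //; last exact: finite_measure_integrable_cst.
  apply/integrableP; split; first exact/measurable_EFinP.
  under eq_integral do rewrite gee0_abs//.
  by rewrite ltey_eq fsn.
apply: le_integrable ig => //; first exact/measurable_EFinP.
move=> w _ /=; rewrite normr_id lee_fin (le_trans _ (ler_norm _))//.
by have := ler_normD (f w - s n w) (s n w); rewrite subrK; have := sM w; lra.
Qed.

Lemma integral_simple_functional (l : {linear X -> R^o}) A s :
  measurable A -> simple_vector s ->
  (\int[P]_(w in A) (l (s w))%:E)%E = (l (simple_integral P A s))%:E.
Proof.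
move=> mA [ms fs].
have lE w : (l (s w))%:E = (\sum_(x <- fset_set (range s)) (l x)%:E * (\1_(s @^-1` [set x]) w)%:E)%E.
  have sw : s w \in fset_set (range s) by rewrite in_fset_set// inE; exists w.
  rewrite (bigD1_seq (s w))//= ?fset_uniq// indicE mem_set//= mule1.
  rewrite big1 ?adde0// => x xs; rewrite indicE memNset ?mule0//=.
  by move=> /esym/eqP; rewrite (negPf xs).
have mS x : measurable (s @^-1` [set x]) by exact: measurable_vector_set1.
under eq_integral do rewrite lE.
have intS x : P.-integrable A (fun w => (\1_(s @^-1` [set x]) w)%:E).
  apply: (@measurable_bounded_integrable _ _ _ P (\1_(s @^-1` [set x]))) => //.
    by rewrite (le_lt_trans (probability_le1 P mA))// ltry.
  exists 1; split => // M M1 w _ /=; rewrite indicE normr_nat (le_trans _ (ltW M1))//.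
  by rewrite lern1 leq_b1.
rewrite integral_sum//; last by move=> x; exact: integrableZl.
rewrite /simple_integral (fsbig_finite _ _ fs)/= linear_sum -sumEFin.
apply: eq_bigr => x _; rewrite integralZl// integral_indic// setIC.
rewrite linearZ/= EFinM muleC fineK// fin_num_measure//.
exact: measurableI.
Qed.

(** A bounded functional passes through the Bochner integral, since it does for
    the approximating simple vectors. *)
Lemma integral_functional (l : {linear X -> R^o}) C A f v : separable X ->
  (forall y, `|l y| <= C * `|y|) -> measurable A ->
  Bochner_integrable P f -> is_Bochner_integral P A f v ->
  P.-integrable A (fun w => (l (f w))%:E) /\
  (\int[P]_(w in A) (l (f w))%:E)%E = (l v)%:E.
Proof.
move=> hsep lC mA bf [mf [s [ss sf] sv]].
have cl := bounded_functional_continuous lC.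
have C0 : 0 <= `|C| by [].
have lC' y : `|l y| <= `|C| * `|y|.
  by rewrite (le_trans (lC y))// ler_wpM2r// ler_norm.
have Cf : P.-integrable A (fun w => (`|C| * `|f w|)%:E).
  apply: (@integrableS _ _ _ P [set: T]) => //.
  under eq_fun do rewrite EFinM.
  by apply: integrableZl => //; exact: Bochner_integrable_norm.
have ml (g : T -> X) : random_vector g -> measurable_fun A (fun w => l (g w)).
  by move=> mg; apply: measurable_funTS; exact: (measurable_continuous_comp mg cl).
have il : P.-integrable A (fun w => (l (f w))%:E).
  apply: le_integrable Cf => //; first by apply/measurable_EFinP; exact: ml.
  by move=> w _ /=; rewrite lee_fin normrM !normr_id.
split => //.
have mfs n : measurable_fun [set: T] (fun w => `|f w - s n w|).
  by apply: measurable_norm_sub => //; case: (ss n).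
have ils n : P.-integrable A (fun w => (l (s n w))%:E).
  have [M sM] := simple_vector_bounded (ss n).
  apply: (@le_integrable _ _ _ P _ _ _ (EFin \o cst (`|C| * M))) => //.
  - by apply/measurable_EFinP; apply: ml; case: (ss n).
  - move=> w _ /=; rewrite lee_fin (le_trans (lC' _))// (le_trans _ (ler_norm _))//.
    by rewrite ler_wpM2l.
  - exact: finite_measure_integrable_cst.
have fI : (\int[P]_(w in A) (l (f w))%:E)%E \is a fin_num by exact: integrable_fin_num.
rewrite -[LHS]fineK//; congr EFin.
set I := fine _; pose J n := l (simple_integral P A (s n)).
have JI : (`|J n - I|)%:E @[n --> \oo] --> 0%E.
  have C0f : (`|C|%:E * \int[P]_w (`|f w - s n w|)%:E @[n --> \oo] --> 0)%E.
    by rewrite -(mule0 `|C|%:E); apply: cvgeZl.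
  apply: squeeze_cvge (cvg_cst _) C0f; apply: nearW => n.
  rewrite lee_fin normr_ge0/=.
  rewrite -abse_EFin EFinB /I fineK// /J -integral_simple_functional// -(integralB_EFin mA (ils n) il).
  apply: le_trans (le_abse_integral _ _ _) _ => //.
    by apply: (measurable_int P); exact: (integrableB mA (ils n) il).
  rewrite -ge0_integralZl//; last exact/measurable_EFinP.
  apply: le_trans (@ge0_subset_integral _ _ _ P A setT mA _ _ _ _ _) => //.
    apply: ge0_le_integral => //.
    + by apply: measurableT_comp => //; apply: (measurable_int P); exact: (integrableB mA (ils n) il).
    + by apply: measurable_funeM; apply: measurable_funTS; exact/measurable_EFinP.
    + move=> w _; rewrite -EFinB abse_EFin -EFinM lee_fin distrC -[_ - l _]linearB.
      exact: lC'.
  by apply: measurable_funeM; exact/measurable_EFinP.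
have JI0 : J n @[n --> \oo] --> I.
  apply/cvgrPdist_le => e e0; move/fine_cvgP: JI => [_ /cvgr_dist_le /(_ e e0)].
  apply: filterS => n /=; rewrite sub0r normrN normr_id distrC.
  exact.
have Jv : J n @[n --> \oo] --> l v by exact: (cvg_comp _ _ sv (cl v)).
exact: (cvg_unique _ JI0 Jv).
Qed.
End bochner.

(** * Comparing integrals over a sub-sigma-algebra *)

Section localization.
Context {d : measure_display} {T : measurableType d} {R : realType}
  (mu : {measure set T -> \bar R}) (G : set (set T)).
Hypothesis (sG : sigma_algebra [set: T] G) (GT : G `<=` @measurable _ T).

Lemma sub_measurableE : @measurable _ (g_sigma_algebraType G) = G.
Proof. exact: sigma_algebra_id. Qed.

Lemma measurable_fun_sub d' (U : measurableType d') (h : T -> U) :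
  measurable_fun [set: g_sigma_algebraType G] (h : g_sigma_algebraType G -> U) ->
  measurable_fun [set: T] h.
Proof.
by move=> mh _ Y mY; apply: GT; rewrite -sub_measurableE; exact: mh.
Qed.

(** To compare two integrals on all events of [G] it is enough to do so on small
    events, up to factors close to one.  This replaces approximation of
    [G]-measurable maps by simple ones. *)
Lemma le_integral_cover (Y Z : T -> \bar R) :
  (forall w, 0 <= Y w)%E -> measurable_fun [set: T] Y ->
  (forall w, 0 <= Z w)%E -> measurable_fun [set: T] Z ->
  (forall e : R, 0 < e -> exists B : nat -> set T,
    [/\ forall i, G (B i), \bigcup_i B i = [set: T] &
     forall i A, G A -> A `<=` B i ->
       (\int[mu]_(w in A) Y w <= (expR e)%:E * \int[mu]_(w in A) Z w)%E]) ->
  forall A, G A -> (\int[mu]_(w in A) Y w <= \int[mu]_(w in A) Z w)%E.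
Proof.
move=> Y0 mY Z0 mZ H A GA.
apply/lee_mul01Pr; first by apply: integral_ge0 => w _; exact: Y0.
move=> r /andP[r0 r1].
have e0 : 0 < - ln r by rewrite oppr_gt0 ln_lt0// r0.
have [B [GB BT HB]] := H _ e0.
suff : (\int[mu]_(w in A) Y w <= (expR (- ln r))%:E * \int[mu]_(w in A) Z w)%E.
  rewrite expRN lnK ?posrE// => h.
  rewrite -lee_pdivlMl//.
have AE : A = \bigcup_i seqDU (fun i => A `&` B i) i.
  by rewrite -seqDU_bigcup_eq -setI_bigcupr BT setIT.
have GS i : G (seqDU (fun i => A `&` B i) i).
  rewrite -sub_measurableE; apply: seqDU_measurable => k.
  by apply: measurableI; rewrite sub_measurableE.
have SB i : seqDU (fun i => A `&` B i) i `<=` B i by move=> w [[_ ]].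
rewrite {1 2}AE !ge0_integral_bigcup//; last 4 first.
- by move=> k; exact: GT.
- exact: measurable_funTS.
- by move=> k; exact: GT.
- exact: measurable_funTS.
rewrite -nneseriesZl//; last by move=> i _; apply: integral_ge0 => w _; exact: Z0.
apply: lee_nneseries => i _; first by move=> _; apply: integral_ge0 => w _; exact: Y0.
by apply: HB.
Qed.

(** The weight is constant up to the factor [expR e] where [h] lies in a
    half-open interval of length [e], and countably many of these cover. *)
Lemma le_integral_weight (Y Z : T -> \bar R) (h : T -> R) :
  (forall w, 0 <= Y w)%E -> measurable_fun [set: T] Y ->
  (forall w, 0 <= Z w)%E -> measurable_fun [set: T] Z ->
  (forall w, 0 <= h w) ->
  measurable_fun [set: g_sigma_algebraType G] (h : g_sigma_algebraType G -> R) ->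
  (forall A, G A -> (\int[mu]_(w in A) Y w <= \int[mu]_(w in A) Z w)%E) ->
  forall A, G A -> (\int[mu]_(w in A) ((expR (- h w))%:E * Y w)
                 <= \int[mu]_(w in A) ((expR (- h w))%:E * Z w))%E.
Proof.
move=> Y0 mY Z0 mZ h0 mh YZ.
have mhT := measurable_fun_sub mh.
have meh : measurable_fun [set: T] (fun w => (expR (- h w))%:E).
  by apply/measurable_EFinP; apply: measurableT_comp => //; exact: measurable_funN.
have meM (V : T -> \bar R) : measurable_fun [set: T] V ->
    measurable_fun [set: T] (fun w => (expR (- h w))%:E * V w)%E.
  by move=> mV; exact: emeasurable_funM.
apply: le_integral_cover => //.
- by move=> w; rewrite mule_ge0// lee_fin expR_ge0.
- exact: meM.
- by move=> w; rewrite mule_ge0// lee_fin expR_ge0.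
- exact: meM.
move=> e e0; exists (fun m => [set w | m%:R * e <= h w < m.+1%:R * e]); split.
- move=> m; rewrite -sub_measurableE -[X in measurable X]setTI.
  rewrite [X in _ `&` X](_ : _ = h @^-1` `[m%:R * e, m.+1%:R * e[).
    by apply: mh.
  by apply/seteqP; split => w /=; rewrite in_itv.
- apply/seteqP; split => // w _; exists (Num.truncn (h w / e)) => //=.
  rewrite -ler_pdivlMr// -ltr_pdivrMr//.
  by apply: truncn_itv; rewrite divr_ge0// ltW.
move=> m A GA AB; have mA := GT GA.
have mYA := measurable_funTS mY; have mZA := measurable_funTS mZ.
apply: (@le_trans _ _ ((expR (- (m%:R * e)))%:E * \int[mu]_(w in A) Y w)%E).
  rewrite -ge0_integralZl//.
  apply: ge0_le_integral => //.
  - by move=> w _; rewrite mule_ge0// lee_fin expR_ge0.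
  - by apply: measurable_funTS; exact: meM.
  - exact: measurable_funeM.
  - move=> w /AB/= /andP[mw _]; rewrite lee_wpmul2r// lee_fin ler_expR lerN2.
    exact: mw.
apply: (@le_trans _ _ ((expR (- (m%:R * e)))%:E * \int[mu]_(w in A) Z w)%E).
  by rewrite lee_wpmul2l ?YZ// lee_fin expR_ge0.
rewrite -ge0_integralZl//.
rewrite -ge0_integralZl//; last 2 first.
- by apply: measurable_funTS; exact: meM.
- by move=> w _; rewrite mule_ge0// lee_fin expR_ge0.
apply: ge0_le_integral => //.
- by move=> w _; rewrite mule_ge0// lee_fin expR_ge0.
- exact: measurable_funeM.
- by apply: measurable_funeM; apply: measurable_funTS; exact: meM.
- move=> w /AB/= /andP[_ wm]; rewrite muleA lee_wpmul2r// -EFinM -expRD lee_fin ler_expR.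
  by move: wm; rewrite -natr1; lra.
Qed.

End localization.

(** * The conditional growth of the hyperbolic cosine of the norm *)

Section one_step.
Context {d : measure_display} {T : measurableType d} {R : realType}
  {P : probability T R} {X : normedModType R}.
Variables (D lam a : R) (G : set (set T)) (f g : T -> X) (v : T -> \bar R).
Hypotheses (hsep : separable X) (hD : smooth2 X D) (l0 : 0 < lam) (a0 : 0 < a)
  (sG : sigma_algebra [set: T] G) (GT : G `<=` @measurable _ T)
  (mf : random_vector_wrt G f) (bg : Bochner_integrable P g)
  (cgf : is_condexp P G g f)
  (ga : {ae P, forall w, `|g w - f w| <= a})
  (hv : is_condexp_ge0 P G (fun w => (`|g w - f w| ^+ 2)%:E) v).

Let psi (x : X) := cosh (lam * `|x|).
Let k := bennett D lam a.

Let bf : Bochner_integrable P f. Proof. by case: cgf. Qed.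
Let mfT : random_vector f. Proof. by case: bf. Qed.
Let mgT : random_vector g. Proof. by case: bg. Qed.

Lemma measurable_cosh_norm d' (U : measurableType d') (h : U -> borel X) :
  measurable_fun [set: U] h -> measurable_fun [set: U] (fun w => psi (h w)).
Proof.
move=> mh; apply: (measurable_continuous_comp mh (phi := psi)) => x.
have cexp (c : R) : {for x, continuous (fun y : X => expR (c * `|y|))}.
  apply: (@continuous_comp _ _ _ (fun y : X => c * `|y|) expR); last exact: continuous_expR.
  by apply: cvgMr; exact: norm_continuous.
have -> : psi = (fun y => (expR (lam * `|y|) + expR (- lam * `|y|)) / 2).
  by apply/funext => y; rewrite /psi /cosh mulNr.
by apply: cvgMl; apply: cvgD; exact: cexp.
Qed.

Let mv : measurable_fun [set: T] v.
Proof. by case: hv => + _ _; exact: measurable_fun_sub. Qed.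

Let v0 w : (0 <= v w)%E. Proof. by case: hv. Qed.

Let mdist : measurable_fun [set: T] (fun w => `|g w - f w|).
Proof. exact: measurable_norm_sub. Qed.

Let msqr : measurable_fun [set: T] (fun w => (`|g w - f w| ^+ 2)%:E).
Proof. by apply/measurable_EFinP; exact: measurable_funX. Qed.

Let psi_ge0 x : 0 <= psi x.
Proof. exact: le_trans ler01 (cosh_ge1 _). Qed.

Let k0 : 0 <= k. Proof. exact: bennett_ge0. Qed.

Let integral_affine A c (V : T -> \bar R) : G A -> 0 <= c ->
  (forall w, 0 <= V w)%E -> measurable_fun [set: T] V ->
  (\int[P]_(w in A) (c%:E * (1 + k%:E * V w)) =
    c%:E * (P A + k%:E * \int[P]_(w in A) V w))%E.
Proof.
move=> GA c0 V0 mV; have mA := GT GA.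
have mVA := measurable_funTS mV.
have kV0 w : (0 <= k%:E * V w)%E by rewrite mule_ge0// lee_fin.
have mkV : measurable_fun A (fun w => k%:E * V w)%E by exact: measurable_funeM.
rewrite ge0_integralZl//; last 2 first.
- by apply: emeasurable_funD => //; exact: measurable_cst.
- by move=> w _; rewrite adde_ge0.
rewrite ge0_integralD// integral_cst// mul1e ge0_integralZl//.
Qed.

(** While [f] stays within [e / lam] of a fixed [x], the functional supporting at
    [x] can be used for all outcomes; being deterministic, it integrates to zero
    against the increment. *)
Let step_at x e A : 0 < e -> G A -> (forall w, A w -> lam * `|f w - x| <= e) ->
  (\int[P]_(w in A) (psi (g w))%:E
    <= (expR e)%:E * \int[P]_(w in A) ((psi x)%:E * (1 + k%:E * v w)))%E.
Proof.
move=> e0 GA Ax; have mA := GT GA.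
have [l [[C lC] hl]] := cosh_norm_supporting x hD l0 a0.
have [_ _ /(_ A GA)[z zg zf]] := cgf.
have [ig Eg] := integral_functional hsep lC mA bg zg.
have [i_f Ef] := integral_functional hsep lC mA bf zf.
pose W w := psi x * (1 + k * `|g w - f w| ^+ 2).
pose Q w := l (g w) - l (f w) + W w.
have W0 w : 0 <= W w by rewrite mulr_ge0// addr_ge0// mulr_ge0// sqr_ge0.
have mW : measurable_fun A W.
  apply: measurable_funTS; apply: measurable_funM => //; apply: measurable_funD => //.
  by apply: measurable_funM => //; exact: measurable_funX.
have EW : (\int[P]_(w in A) (W w)%:E
    = \int[P]_(w in A) ((psi x)%:E * (1 + k%:E * v w)))%E.
  transitivity (\int[P]_(w in A) ((psi x)%:E * (1 + k%:E * (`|g w - f w| ^+ 2)%:E)))%E.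
    by apply: eq_integral => w _; rewrite /W EFinM EFinD EFinM.
  rewrite !integral_affine//.
  by case: hv => _ _ ->.
have sqr_fin : (\int[P]_(w in A) (`|g w - f w| ^+ 2)%:E < +oo)%E.
  apply: (@le_lt_trans _ _ (\int[P]_(w in A) (a ^+ 2)%:E)%E); last first.
    rewrite integral_cst// lte_mul_pinfty ?lee_fin ?sqr_ge0//.
    by rewrite (le_lt_trans (probability_le1 P mA))// ltry.
  apply: ae_ge0_le_integral => //.
  - exact: measurable_funTS.
  - by move=> w _; rewrite lee_fin sqr_ge0.
  - by apply: filterS ga => w ha _; rewrite lee_fin; apply: lerXn2r => //; rewrite nnegrE// ltW.
have iW : P.-integrable A (EFin \o W).
  apply/integrableP; split; first exact/measurable_EFinP.
  under eq_integral do rewrite gee0_abs ?lee_fin//.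
  rewrite EW integral_affine//; case: hv => _ _ ->//.
  rewrite lte_mul_pinfty ?lee_fin// lte_add_pinfty//.
    by rewrite (le_lt_trans (probability_le1 P mA))// ltry.
  by rewrite lte_mul_pinfty ?lee_fin.
have ilgf : P.-integrable A (EFin \o (fun w => l (g w) - l (f w))).
  exact: (integrableB mA ig i_f).
have iQ : P.-integrable A (EFin \o Q) by exact: (integrableD mA ilgf iW).
have EQ : (\int[P]_(w in A) (Q w)%:E = \int[P]_(w in A) (W w)%:E)%E.
  rewrite (integralD_EFin mA ilgf iW) (integralB_EFin mA ig i_f) Eg Ef.
  by rewrite -EFinB subrr add0e.
(* Q may be negative on the null set where the increment exceeds a, which is why
   its positive part is integrated below *)
have aeQ : {ae P, forall w, A w -> psi (g w) <= expR e * Q w}.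
  apply: filterS ga => w ha Aw.
  apply: (@le_trans _ _ (expR e * psi (x + (g w - f w)))).
    apply: cosh_shift => //; try by rewrite mulr_ge0// ltW.
      have {1}-> : g w = (x + (g w - f w)) + (f w - x).
        by rewrite addrAC !subrKC.
      apply: (@le_trans _ _ (lam * (`|x + (g w - f w)| + `|f w - x|))).
        by rewrite ler_pM2l// ler_normD.
      by rewrite mulrDr lerD2l Ax.
    exact: ltW.
  rewrite ler_pM2l ?expR_gt0//; apply: le_trans (hl _ ha) _.
  by rewrite /Q /W linearB/= -/(psi x) -/k; lra.
have mQ : measurable_fun A Q by (apply/measurable_EFinP; apply: (measurable_int P); exact: iQ).
rewrite -EW -EQ -(@ae_eq_integral _ _ _ P A (fun w => (Q w)%:E) (fun w => (Num.max (Q w) 0)%:E)) //.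
- rewrite -ge0_integralZl//.
  + apply: ae_ge0_le_integral => //.
    * by move=> w _; rewrite lee_fin.
    * by apply: measurable_funTS; apply/measurable_EFinP; exact: measurable_cosh_norm.
    * by move=> w _; rewrite -EFinM lee_fin mulr_ge0 ?expR_ge0// le_max lexx orbT.
    * by apply: measurable_funeM; apply/measurable_EFinP; exact: measurable_maxr.
    * apply: filterS aeQ => w h Aw; rewrite -EFinM lee_fin (le_trans (h Aw))//.
      by rewrite ler_pM2l ?expR_gt0// le_max lexx.
  + by apply/measurable_EFinP; exact: measurable_maxr.
  + by move=> w _; rewrite lee_fin le_max lexx orbT.
- by apply/measurable_EFinP; exact: measurable_maxr.
- exact/measurable_EFinP.
- apply: filterS aeQ => w h Aw; congr EFin; apply/max_idPl.
  by rewrite -(pmulr_rge0 _ (expR_gt0 e)) (le_trans _ (h Aw)).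
Qed.

(** One step of the process.  On the countably many events where [f] is close to
    a point of a dense sequence, [step_at] applies with that point in place of
    [f]; so no measurable choice of the functional supporting at [f w] is
    needed. *)
Lemma cosh_step : forall A, G A ->
  (\int[P]_(w in A) (psi (g w))%:E
    <= \int[P]_(w in A) ((psi (f w))%:E * (1 + k%:E * v w)))%E.
Proof.
have aff0 w : (0 <= 1 + k%:E * v w)%E by rewrite adde_ge0// mule_ge0// lee_fin.
have maff : measurable_fun [set: T] (fun w => 1 + k%:E * v w)%E.
  by apply: emeasurable_funD => //; exact: measurable_funeM.
have mpsi (h : T -> X) : random_vector h -> measurable_fun [set: T] (fun w => (psi (h w))%:E).
  by move=> mh; apply/measurable_EFinP; exact: measurable_cosh_norm.
have mZ : measurable_fun [set: T] (fun w => (psi (f w))%:E * (1 + k%:E * v w))%E.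
  by apply: emeasurable_funM => //; exact: mpsi.
apply: (le_integral_cover sG GT) => //.
- by move=> w; rewrite lee_fin.
- exact: mpsi.
- by move=> w; rewrite mule_ge0// lee_fin.
move=> e0 e00; pose e := e0 / 2; have e1 : 0 < e by rewrite divr_gt0.
have [u hu] := separable_seq hsep.
exists (fun i => [set w | `|f w - u i| < e / lam]); split.
- move=> i; rewrite -(sub_measurableE sG) -[X in measurable X]setTI.
  rewrite [X in _ `&` X](_ : _ = (fun w => `|f w - u i|) @^-1` `]-oo, e / lam[).
    by apply: (@measurable_norm_subr _ (g_sigma_algebraType G)).
  by apply/seteqP; split => w /=; rewrite in_itv.
- apply/seteqP; split => // w _.
  by have [i hi] := hu (f w) (e / lam) (divr_gt0 e1 l0); exists i.
move=> i A GA AB; have mA := GT GA.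
have close w : A w -> lam * `|f w - u i| <= e.
  by move=> /AB/= /ltW; rewrite ler_pdivlMr// mulrC.
apply: le_trans (step_at e1 GA close) _.
have -> : expR e0 = expR e * expR e by rewrite -expRD; congr expR; rewrite /e; field.
rewrite (EFinM (expR e) (expR e)) -muleA lee_wpmul2l ?lee_fin ?expR_ge0//.
rewrite -ge0_integralZl//; last 2 first.
- exact: measurable_funTS.
- by move=> w _; rewrite mule_ge0// lee_fin.
apply: ge0_le_integral => //.
- by move=> w _; rewrite mule_ge0// lee_fin.
- by apply: measurable_funTS; apply: emeasurable_funM => //.
- by apply: measurable_funeM; exact: measurable_funTS.
move=> w Aw; rewrite muleA lee_wpmul2r// -EFinM lee_fin.
apply: cosh_shift; try by rewrite mulr_ge0// ltW.
  have := ler_normD (f w) (u i - f w); rewrite subrKC distrC.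
  rewrite -(ler_pM2l l0) mulrDr => /le_trans; apply.
  by rewrite lerD2l close.
Qed.

End one_step.

(** * Ville's maximal inequality *)

Section ville.
Context {d : measure_display} {T : measurableType d} {R : realType}
  (mu : {measure set T -> \bar R}) (F : (set (set T))^nat) (S : (T -> R)^nat).
Hypotheses (fF : filtration F)
  (mS : forall n, measurable_fun [set: g_sigma_algebraType (F n)]
                    (S n : g_sigma_algebraType (F n) -> R))
  (S0 : forall n w, 0 <= S n w)
  (superS : forall n A, F n A ->
    (\int[mu]_(w in A) (S n.+1 w)%:E <= \int[mu]_(w in A) (S n w)%:E)%E).

Let FE n : @measurable _ (g_sigma_algebraType (F n)) = F n.
Proof. by apply: sub_measurableE; case: fF => /(_ n). Qed.

Let FT n : F n `<=` @measurable _ T.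
Proof. by case: fF => _ /(_ n). Qed.

Let mST n : measurable_fun [set: T] (EFin \o S n).
Proof.
apply/measurable_EFinP; apply: (measurable_fun_sub _ (@FT n)) => //.
by case: fF => /(_ n).
Qed.

Variable c : R.
Hypothesis c0 : 0 <= c.

Let below n := [set w | forall i, (i <= n)%N -> S i w < c].

Let F_below n : F n (below n).
Proof.
elim: n => [|n IH].
  rewrite (_ : below 0%N = [set: T] `&` S 0%N @^-1` `]-oo, c[).
    rewrite -FE; apply: mS => //.
  apply/seteqP; split => w /=; rewrite in_itv/=.
    by move=> /(_ 0%N) /(_ (leqnn _)).
  by move=> [_ h] i; rewrite leqn0 => /eqP ->.
rewrite (_ : below n.+1 = below n `&` ([set: T] `&` S n.+1 @^-1` `]-oo, c[)).
  rewrite -FE; apply: measurableI.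
    by rewrite FE; case: fF => _ _ /(_ n); exact.
  by apply: mS.
apply/seteqP; split => w /=; rewrite in_itv/=.
  by move=> h; split => [i ni|]; [apply: h; exact: leqW|split => //; exact: h].
by move=> [h [_ hn]] i; rewrite leq_eqVlt => /predU1P[->//|]; exact: h.
Qed.

(** Markov's inequality on the part of [A] where the threshold is reached. *)
Let step k A B : measurable A -> measurable B -> (forall w, (A `\` B) w -> c <= S k w) ->
  (c%:E * mu (A `\` B) + \int[mu]_(w in A `&` B) (S k w)%:E
    <= \int[mu]_(w in A) (S k w)%:E)%E.
Proof.
move=> mA mB cAB.
have mAB : measurable (A `\` B) by exact: measurableD.
have mAIB : measurable (A `&` B) by exact: measurableI.
rewrite -[A in leRHS](setUIDK A B) ge0_integral_setU//; last 3 first.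
- by apply: measurable_funTS; exact: mST.
- by move=> w _; rewrite lee_fin.
- by apply/disj_setPS => w [[_ ?] []].
rewrite addeC; apply: leeD => //; rewrite -integral_cst//.
apply: ge0_le_integral => //.
by apply: measurable_funTS; exact: mST.
Qed.

(** Optional stopping at the first time the threshold is reached, with the mass
    that has already reached it counted at the value [c]. *)
Let hitting_bound n :
  (c%:E * mu (~` below n) + \int[mu]_(w in below n) (S n w)%:E
    <= \int[mu]_w (S 0%N w)%:E)%E.
Proof.
have m_below k : measurable (below k) by exact/FT/F_below.
elim: n => [|n IH].
  have := @step 0%N setT (below 0%N) measurableT (m_below _).
  rewrite setTD setTI; apply => w h; rewrite leNgt; apply/negP => Sc.
  by apply: h => i; rewrite leqn0 => /eqP ->.
apply: le_trans IH.
have belowS : below n.+1 `<=` below n by move=> w h i ni; apply: h; exact: leqW.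
have -> : ~` below n.+1 = ~` below n `|` (below n `\` below n.+1).
  apply/seteqP; split => w /=.
    by move=> h; have [?|?] := pselect (below n w); [right|left].
  by case=> [h /belowS|[]].
rewrite measureU//; last 3 first.
- exact: measurableC.
- exact: measurableD.
- by apply/seteqP; split => // w [h [/h]].
rewrite ge0_muleDr// -addeA; apply: leeD => //.
apply: le_trans (superS (F_below n)).
have := @step n.+1 (below n) (below n.+1) (m_below _) (m_below _).
rewrite (setIidr belowS); apply => w [bn h].
rewrite leNgt; apply/negP => Sc; apply: h => i.
by rewrite leq_eqVlt => /predU1P[->//|]; exact: bn.
Qed.

(** Ville's maximal inequality, for a process whose integral over each event of
    the past does not increase. *)
Lemma ville :
  (c%:E * mu (\bigcup_n [set w | (c <= S n w)%R]) <= \int[mu]_w (S 0%N w)%:E)%E.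
Proof.
have m_below k : measurable (below k) by exact/FT/F_below.
have -> : \bigcup_n [set w | c <= S n w] = \bigcup_n ~` below n.
  apply/seteqP; split => w [n _ /=].
    by move=> cS; exists n => //= /(_ n (leqnn n)); rewrite ltNge cS.
  move=> /existsNP[i /not_implyP[_ h]]; exists i => //=.
  by rewrite leNgt; apply/negP.
have cv : mu (~` below n) @[n --> \oo] --> mu (\bigcup_n ~` below n).
  apply: nondecreasing_cvg_mu => //.
  - by move=> n; exact: measurableC.
  - by apply: bigcup_measurable => n _; exact: measurableC.
  - move=> m n mn; rewrite subsetEset; apply: subsetC => w h i im.
    by apply: h; exact: leq_trans mn.
have cv' : (c%:E * mu (~` below n))%E @[n --> \oo] --> (c%:E * mu (\bigcup_n ~` below n))%E.
  exact: cvgeZl.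
rewrite -(cvg_lim _ cv')//; apply: lime_le; first by apply/cvg_ex; eexists; exact: cv'.
apply: nearW => n; apply: le_trans (hitting_bound n).
by rewrite leeDl// integral_ge0// => w _; rewrite lee_fin.
Qed.
End ville.

(** * The exponential tail bound *)

Section tail.
Context {d : measure_display} {T : measurableType d} {R : realType}
  {P : probability T R} {X : normedModType R}.
Variables (D lam a B : R) (F : (set (set T))^nat) (f : (T -> X)^nat)
  (v : (T -> \bar R)^nat).
Hypotheses (hsep : separable X) (hD : smooth2 X D) (l0 : 0 < lam) (a0 : 0 < a)
  (hf : martingale0 P F f) (hv : cond_variances P F f v)
  (hda : {ae P, forall w, forall n, `|f n.+1 w - f n w| <= a})
  (hvB : {ae P, forall w, \sum_(1 <= j <oo) v j w <= B%:E}%E).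

Let psi (x : X) := cosh (lam * `|x|).
Let k := bennett D lam a.
Let k0 : 0 <= k. Proof. exact: bennett_ge0. Qed.

Let sF n : sigma_algebra [set: T] (F n).
Proof. by case: hf => -[[/(_ n)]]. Qed.

Let FT n : F n `<=` @measurable _ T.
Proof. by case: hf => -[[_ /(_ n)]]. Qed.

Let FS n : F n `<=` F n.+1.
Proof. by case: hf => -[[_ _ /(_ n)]]. Qed.

Let F_le m n : (m <= n)%N -> F m `<=` F n.
Proof.
elim: n => [|n IH]; first by rewrite leqn0 => /eqP ->.
by rewrite leq_eqVlt => /predU1P[->//|mn]; exact: subset_trans (IH mn) (@FS n).
Qed.

Let mf n : random_vector_wrt (F n) (f n).
Proof. by case: hf => -[_ /(_ n)]. Qed.

Let v0 n w : (0 <= v n.+1 w)%E.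
Proof. by case: (hv (isT : (1 <= n.+1)%N)). Qed.

Let mv n : measurable_fun [set: g_sigma_algebraType (F n)]
  (v n.+1 : g_sigma_algebraType (F n) -> \bar R).
Proof. by case: (hv (isT : (1 <= n.+1)%N)). Qed.

(** The exponent that turns [cosh (lam * |f n|)] into a supermartingale; [comp n.+1]
    is known at time [n]. *)
Let comp n w := k * \sum_(j < n) fine (v j.+1 w).

Let comp0 n w : 0 <= comp n w.
Proof. by rewrite mulr_ge0// sumr_ge0// => j _; rewrite fine_ge0. Qed.

Let mcomp n : measurable_fun [set: g_sigma_algebraType (F n)]
  (comp n.+1 : g_sigma_algebraType (F n) -> R).
Proof.
apply: measurable_funM => //; apply: measurable_sum => j.
have mfine : measurable_fun [set: g_sigma_algebraType (F n)]
    (fine \o (v j.+1 : g_sigma_algebraType (F n) -> \bar R)).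
  apply: measurableT_comp => //.
  move=> _ Y mY; rewrite (sub_measurableE (sF n)).
  apply: (F_le (ltn_ord j : (j <= n)%N)); rewrite -(sub_measurableE (sF j)).
  exact: mv.
exact: mfine.
Qed.

Let S n w := expR (- comp n w) * psi (f n w).

Let mS n : measurable_fun [set: g_sigma_algebraType (F n)]
  (S n : g_sigma_algebraType (F n) -> R).
Proof.
apply: measurable_funM; last first.
  by apply: measurable_cosh_norm; exact: mf.
apply: measurableT_comp => //; apply: measurable_funN.
case: n => [|n].
  rewrite (_ : comp 0 = cst 0); first exact: measurable_cst.
  by apply/funext => w; rewrite /comp big_ord0 mulr0.
move=> _ Y mY; rewrite (sub_measurableE (sF n.+1)); apply: FS.
rewrite -(sub_measurableE (sF n)); exact: mcomp.
Qed.

Let psi_ge0 x : 0 <= psi x.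
Proof. exact: le_trans ler01 (cosh_ge1 _). Qed.

Let S0 n w : 0 <= S n w.
Proof. by rewrite mulr_ge0// expR_ge0. Qed.

Let partial_sum n w : (\sum_(1 <= j <oo) v j w <= B%:E)%E ->
  (\sum_(j < n) v j.+1 w <= B%:E)%E.
Proof.
apply: le_trans.
rewrite -(big_mkord xpredT (fun j => v j.+1 w)) -(big_add1 _ _ 0 n.+1 xpredT (fun j => v j w)).
by apply: nneseries_lim_ge => -[].
Qed.

Let v_fin w : (\sum_(1 <= j <oo) v j w <= B%:E)%E -> forall n, v n.+1 w \is a fin_num.
Proof.
move=> /partial_sum h n; rewrite ge0_fin_numE//.
apply: le_lt_trans (ltry B); apply: le_trans (h n.+1).
by rewrite big_ord_recr/= leeDr// sume_ge0.
Qed.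

Let comp_le n w : (\sum_(1 <= j <oo) v j w <= B%:E)%E -> comp n w <= k * B.
Proof.
move=> h; rewrite ler_wpM2l// -lee_fin -sumEFin.
under eq_bigr do rewrite fineK ?v_fin//.
exact: partial_sum.
Qed.

(** [1 + u <= expR u] lets the exponential absorb the factor gained in
    [cosh_step]. *)
Let superS n A : F n A ->
  (\int[P]_(w in A) (S n.+1 w)%:E <= \int[P]_(w in A) (S n w)%:E)%E.
Proof.
move=> FA; have mA := FT FA.
have [[_ _ bf cf] _] := hf.
have step : forall A, F n A -> (\int[P]_(w in A) (psi (f n.+1 w))%:E
    <= \int[P]_(w in A) ((psi (f n w))%:E * (1 + k%:E * v n.+1 w)))%E.
  apply: cosh_step => //.
  - by move: hda; apply: filterS => w; exact.
  - exact: (hv (isT : (1 <= n.+1)%N)).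
have mpsi m : measurable_fun [set: T] (fun w => (psi (f m w))%:E).
  apply/measurable_EFinP; apply: measurable_cosh_norm.
  by apply: (measurable_fun_sub (sF m) (@FT m)); exact: mf.
have aff0 w : (0 <= 1 + k%:E * v n.+1 w)%E by rewrite adde_ge0// mule_ge0// lee_fin.
have mZ : measurable_fun [set: T] (fun w => (psi (f n w))%:E * (1 + k%:E * v n.+1 w))%E.
  apply: emeasurable_funM => //; apply: emeasurable_funD => //.
  by apply: measurable_funeM; exact: (measurable_fun_sub (sF n) (@FT n)).
have Y0 w : (0 <= (psi (f n.+1 w))%:E)%E by rewrite lee_fin.
have Z0 w : (0 <= (psi (f n w))%:E * (1 + k%:E * v n.+1 w))%E.
  by rewrite mule_ge0// lee_fin.
have weighted := le_integral_weight (sF n) (@FT n) Y0 (mpsi n.+1) Z0 mZ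
  (comp0 n.+1) (@mcomp n) step FA.
apply: le_trans weighted _.
have mST m : measurable_fun [set: T] (EFin \o S m).
  by apply/measurable_EFinP; exact: (measurable_fun_sub (sF m) (@FT m)).
apply: ae_ge0_le_integral => //.
- by move=> w _; rewrite !mule_ge0// lee_fin ?expR_ge0.
- apply: measurable_funTS; apply: emeasurable_funM => //.
  apply/measurable_EFinP; apply: measurableT_comp => //; apply: measurable_funN.
  exact: (measurable_fun_sub (sF n) (@FT n)).
- by move=> w _; rewrite lee_fin.
- by apply: measurable_funTS; exact: mST.
- move: hvB; apply: filterS => w /v_fin /(_ n) vf _.
  rewrite -(fineK vf).
  have -> : (1 + k%:E * (fine (v n.+1 w))%:E = (1 + k * fine (v n.+1 w))%:E)%E by [].
  rewrite -!EFinM lee_fin /S.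
  have -> : comp n.+1 w = comp n w + k * fine (v n.+1 w).
    by rewrite /comp big_ord_recr/= mulrDr.
  rewrite mulrCA [leRHS]mulrC ler_wpM2l// opprD expRD -mulrA ler_piMr ?expR_ge0//.
  rewrite expRN mulrC ler_pdivrMr ?expR_gt0// mul1r.
  exact: expR_ge1Dx.
Qed.

Lemma measurable_max_norm r : measurable [set w | (r%:E <= max_norm f w)%E].
Proof.
rewrite -[X in measurable X]setTI.
apply: emeasurable_fun_c_infty => //.
have -> : max_norm f = (fun w => esups (fun j => (`|f j w|)%:E) 0).
  apply/funext => w; rewrite /max_norm /esups/= /sdrop; congr ereal_sup.
  by apply/seteqP; split => x [j _ <-]; exists j.
apply: measurable_fun_esups => n; apply/measurable_EFinP.
apply: (measurable_continuous_comp _ (@norm_continuous _ X)).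
by apply: (measurable_fun_sub (sF n) (@FT n)); exact: mf.
Qed.

(** Ville's inequality for [S], which dominates a multiple of [expR (lam * |f n|)]
    almost surely.  The supremum defining [max_norm] need not be attained, so the
    argument is run at levels [r'] below [r]. *)
Lemma exponential_tail r :
  (P [set w | r%:E <= max_norm f w]%E <= (2 * expR (k * B - lam * r))%:E)%E.
Proof.
apply/lee_mul01Pr => // s /andP[s0 s1].
(* s is the factor lost in the bound when the level r is lowered to r' *)
pose e := - ln s; have e0 : 0 < e by rewrite oppr_gt0 ln_lt0// s0.
have sE : s = expR (- e) by rewrite /e opprK lnK.
pose r' := r - e / lam; have r'r : r' < r by rewrite ltrBlDr ltrDl divr_gt0.
pose c := expR (- (k * B)) * (expR (lam * r') / 2).
have c0 : 0 < c by rewrite mulr_gt0 ?expR_gt0// divr_gt0 ?expR_gt0.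
have fF : filtration F by case: hf => -[].
have ES0 : (\int[P]_w (S 0 w)%:E = 1)%E.
  rewrite (_ : (fun w => (S 0 w)%:E) = cst 1%E).
    by rewrite integral_cst// mul1e; exact: probability_setT.
  apply/funext => w; rewrite /S /comp big_ord0 mulr0 oppr0 expR0 mul1r.
  case: hf => _ ->; rewrite /psi normr0 mulr0 /cosh oppr0 expR0.
  by rewrite (_ : (1 + 1) / 2 = 1) //; field.
have := @ville _ _ _ P F S fF mS S0 superS c (ltW c0); rewrite ES0 => hville.
have mc : measurable (\bigcup_n [set w | c <= S n w]).
  apply: bigcup_measurable => n _; rewrite -[X in measurable X]setTI.
  rewrite [X in _ `&` X](_ : _ = S n @^-1` `[c, +oo[).
    by apply: (measurable_fun_sub (sF n) (@FT n) (@mS n)).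
  by apply/seteqP; split => w /=; rewrite in_itv/= andbT.
have [N [mN N0 hN]] := hvB.
have sub : [set w | r%:E <= max_norm f w]%E `<=` \bigcup_n [set w | c <= S n w] `|` N.
  move=> w /= rw; have [hw|hw] := pselect ((\sum_(1 <= j <oo) v j w <= B%:E)%E); last first.
    by right; exact: hN.
  left; have : (r'%:E < max_norm f w)%E by apply: lt_le_trans rw; rewrite lte_fin.
  move=> /ereal_sup_gt[_ [n _ <-]]; rewrite lte_fin => hn; exists n => //=.
  rewrite /c /S ler_pM ?expR_ge0 ?divr_ge0 ?expR_ge0//.
    by rewrite ler_expR lerN2 comp_le.
  apply: (@le_trans _ _ (expR (lam * `|f n w|) / 2)).
    by rewrite ler_pM2r ?invr_gt0// ler_expR ler_pM2l// ltW.
  by rewrite /psi /cosh ler_pM2r ?invr_gt0// lerDl expR_ge0.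
have hP : (P [set w | r%:E <= max_norm f w] <= P (\bigcup_n [set w | (c <= S n w)%R]))%E.
  apply: (@le_trans _ _ (P (\bigcup_n [set w | (c <= S n w)%R] `|` N))).
    by apply: le_measure => //; rewrite inE; [exact: measurable_max_norm|exact: measurableU].
  apply: le_trans (measureU2 _ _ _) _ => //.
  by rewrite -[leRHS]adde0 leeD// [leLHS]N0.
have -> : 2 * expR (k * B - lam * r) = s / c.
  rewrite sE /c /r' mulrBr (mulrC lam (e / lam)) divfK ?gt_eqF//.
  rewrite !expRD !expRN; field; rewrite !gt_eqF ?expR_gt0//.
rewrite EFinM lee_pmul2l// -(mul1e (c^-1)%:E) lee_pdivlMr// muleC.
by apply: le_trans hville; rewrite lee_pmul2l.
Qed.

End tail.

(** * Optimization of the exponent *)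

Section essential_bounds.
Context {d : measure_display} {T : measurableType d} {R : realType}
  (P : probability T R).

Lemma ae_Lnorm_oo (g : T -> \bar R) (c : \bar R) : ('N[P]_+oo[g] <= c)%E ->
  {ae P, forall w, `|g w| <= c}%E.
Proof.
by rewrite unlock [X in (_ < X)%E](probability_setT P) lte01 => /ess_supP.
Qed.

Lemma ae_mdiff_le (X : normedModType R) (f : (T -> X)^nat) (a : R) :
  ('N[P]_+oo[max_norm (mdiff f)] <= a%:E)%E ->
  {ae P, forall w, forall n, `|f n.+1 w - f n w| <= a}.
Proof.
move=> /ae_Lnorm_oo; apply: filterS => w h n.
rewrite -lee_fin; apply: le_trans h; apply: le_trans (lee_abs _).
by apply: ereal_sup_ubound; exists n.+1.
Qed.

Lemma ae_s2_le (v : (T -> \bar R)^nat) (c : R) : 0 <= c ->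
  (forall n w, 0 <= v n.+1 w)%E -> ('N[P]_+oo[s2 v] <= c%:E)%E ->
  {ae P, forall w, \sum_(1 <= j <oo) v j w <= (c ^+ 2)%:E}%E.
Proof.
move=> c0 v0 /ae_Lnorm_oo; apply: filterS => w h.
have sum0 : (0 <= \sum_(1 <= j <oo) v j w)%E by apply: nneseries_ge0 => -[].
rewrite -lee_sqrt ?lee_fin ?sqr_ge0//.
by rewrite (le_trans (lee_abs _))// (le_trans h)// EFin_expe sqrte_sqr gee0_abs.
Qed.

End essential_bounds.

(** The choice of [lam] minimizes the exponent of [exponential_tail] at the bound
    [(b / D) ^+ 2] for the total conditional variance. *)
Lemma bennett_exponent (R : realType) (D a b r : R) :
  0 < D -> 0 < a -> 0 < b -> 0 <= r ->
  let lam := ln (1 + r * a / b ^+ 2) / a in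
  bennett D lam a * (b / D) ^+ 2 - lam * r =
  r / a - (r / a + b ^+ 2 / a ^+ 2) * ln (1 + r * a / b ^+ 2).
Proof.
move=> D0 a0 b0 r0 lam.
have u0 : 0 < 1 + r * a / b ^+ 2.
  by rewrite ltr_pwDl// divr_ge0 ?mulr_ge0 ?sqr_ge0// ltW.
rewrite /bennett /lam divfK ?gt_eqF// lnK ?posrE//.
by field; rewrite !gt_eqF.
Qed.

(** With [u = r a / b ^+ 2], the power is the exponential of
    [r / a * (1 - ln u)]: replace [ln (1 + u)] by [ln u] and drop the nonpositive
    term [- b ^+ 2 / a ^+ 2 * ln (1 + u)]. *)
Lemma bennett_le_power (R : realType) (a b r : R) :
  0 < a -> 0 < b -> 0 < r ->
  expR (r / a - (r / a + b ^+ 2 / a ^+ 2) * ln (1 + r * a / b ^+ 2)) <=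
  ((expR 1 * b ^+ 2) / (r * a)) `^ (r / a).
Proof.
move=> a0 b0 r0; pose u := r * a / b ^+ 2.
have b20 : 0 < b ^+ 2 by rewrite exprn_gt0.
have u0 : 0 < u by rewrite divr_gt0 ?mulr_gt0.
have -> : expR 1 * b ^+ 2 / (r * a) = expR 1 / u.
  by rewrite /u; field; rewrite !gt_eqF.
have eu0 : expR 1 / u != 0 by rewrite gt_eqF// divr_gt0// expR_gt0.
rewrite /powR (negPf eu0) ler_expR -/u.
rewrite ln_div ?posrE ?expR_gt0// expRK.
have L0 : 0 <= ln (1 + u) by rewrite ln_ge0// lerDl ltW.
have Lu : ln u <= ln (1 + u) by rewrite ler_ln ?posrE ?addr_gt0// lerDr.
have p0 : 0 <= r / a by rewrite divr_ge0 ?ltW.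
have q0 : 0 <= b ^+ 2 / a ^+ 2 by rewrite divr_ge0 ?sqr_ge0.
have := ler_wpM2l p0 Lu; have := mulr_ge0 q0 L0.
by rewrite mulrBr mulr1 mulrDl; lra.
Qed.

Theorem theorem3p4 (R : realType) (D : R) (X : completeNormedModType R)
  (d : measure_display) (T : measurableType d) (P : probability T R)
  (F : (set (set T))^nat) (f : (T -> X)^nat) (v : (T -> \bar R)^nat)
  (a b : R)
  (hD : 0 < D)
  (hsmooth : smooth2 X D)
  (hsep : separable X)
  (hf : martingale0 P F f)
  (hv : cond_variances P F f v)
  (ha : 0 < a) (hb : 0 < b)
  (hd : ('N[P]_+oo[max_norm (mdiff f)] <= a%:E)%E)
  (hs : ('N[P]_+oo[s2 v] <= (b / D)%:E)%E)
  (r : R) (hr : 0 <= r) :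
  let bound :=
    2 * expR (r / a - (r / a + b ^+ 2 / a ^+ 2) * ln (1 + r * a / b ^+ 2)) in
  (P [set w | r%:E <= max_norm f w]%E <= bound%:E)%E /\
  bound <= (if r == 0 then 2
            else 2 * ((expR 1 * b ^+ 2) / (r * a)) `^ (r / a)).
Proof.
move=> bound.
(* lam vanishes at r = 0, where the bound is 2 *)
have [r0|r0] := eqVneq r 0.
  have bound2 : bound = 2.
    by rewrite /bound r0 !mul0r addr0 ln1 mulr0 subr0 expR0 mulr1.
  rewrite bound2; split => //.
  apply: (@le_trans _ _ 1%E); last by rewrite lee_fin; lra.
  apply: probability_le1; exact: (measurable_max_norm hf).
have rgt0 : 0 < r by rewrite lt_neqAle eq_sym r0.
split; last by rewrite /bound ler_pM2l// bennett_le_power.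
rewrite /bound -(bennett_exponent hD ha hb hr).
have lam0 : 0 < ln (1 + r * a / b ^+ 2) / a.
  by rewrite divr_gt0// ln_gt0// ltrDl divr_gt0 ?mulr_gt0 ?exprn_gt0.
apply: (exponential_tail hsep hsmooth lam0 ha hf hv).
- exact: ae_mdiff_le.
- apply: ae_s2_le => //; first by rewrite divr_ge0 ?ltW.
  by move=> n w; case: (hv n.+1 isT).
Qed.
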